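(* Assume that $y:\mathbb{R}\to\mathscr{L}_0$ satisfies $\partial_sy(s)+\nabla_0\mathcal{A}_0(y(s))=0$ for all $s\in\mathbb{R}$ and that the limits $\lim_{s\to\pm\infty}y(s)$ exist in $\mathscr{L}_0$. Then there exist integers $m_j^-\le m_j^+$, $1\le j\le n$, such that, with $V=V_{\{m_j^-,m_j^+\}_{1\le j\le n}}$, the trace of $y$ is contained entirely in $V\times\mathfrak{t}^k$, i.e. $y(s)\in V\times\mathfrak{t}^k$ for all $s\in\mathbb{R}$.
   Context: Let $1\le k\le n$ be integers and let $A=(A_{jr})$ be an $n\times k$ matrix with integer entries. The torus $T^k=\{e^{iv}:v\in\mathbb{R}^k\}$ acts on $\mathbb{C}^n$ by $\rho(e^{iv})z=(e^{i(Av)_1}z_1,\dots,e^{i(Av)_n}z_n)$. Its Lie algebra is $\mathfrak{t}^k=i\mathbb{R}^k$ with the standard inner product, and $\mathbb{C}^n$ carries its standard real inner product. The moment map is $\mu:\mathbb{C}^n\to\mathfrak{t}^k$, $\mu(z)=\frac{i}{2}A^T(|z_1|^2,\dots,|z_n|^2)^T$. Standing assumption (H): $\mu$ is proper and $\tau\in\mathfrak{t}^k$ is a regular value of $\mu$. $S^1=\mathbb{R}/\mathbb{Z}$, $\mathscr{L}_0=C^\infty(S^1,\mathbb{C}^n)\times\mathfrak{t}^k$, $\lambda=\sum_jy_j\,dx_j$ (where $z_j=x_j+iy_j$), and $\mathcal{A}_0(z,\eta)=\int_0^1\lambda(z)(\partial_tz)\,dt+\langle\eta,\int_0^1\mu(z(t))dt-\tau\rangle$.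 $\nabla_0\mathcal{A}_0$ is the gradient with respect to the $L^2$-metric $g_0((\hat z_1,\hat\eta_1),(\hat z_2,\hat\eta_2))=\int_0^1\langle\hat z_1,\hat z_2\rangle dt+\langle\hat\eta_1,\hat\eta_2\rangle$ on $\mathscr{L}_0$. A map $y=(z,\eta):\mathbb{R}\to\mathscr{L}_0$ is understood as an element of $C^\infty(\mathbb{R}\times S^1,\mathbb{C}^n)\times C^\infty(\mathbb{R},\mathfrak{t}^k)$, and limits in $\mathscr{L}_0$ are taken in the $C^\infty$-topology. For integers $m_j^-\le m_j^+$, $V_{\{m_j^-,m_j^+\}}\subset C^\infty(S^1,\mathbb{C}^n)$ is the space of loops $z=(z_1,\dots,z_n)$ of the form $z_j(t)=\sum_{m=m_j^-}^{m_j^+}z_{jm}e^{2\pi imt}$ with $z_{jm}\in\mathbb{C}$. *)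

(* Defs.v *)
From mathcomp Require Import all_boot all_order all_algebra.
From mathcomp Require Import complex.
From mathcomp Require Import all_classical all_reals all_analysis.
Set Implicit Arguments.
Unset Strict Implicit.
Unset Printing Implicit Defensive.
Import Order.TTheory GRing.Theory Num.Theory numFieldNormedType.Exports.
Local Open Scope classical_set_scope.
Local Open Scope ring_scope.

(** The real vector space underlying C^n: the pair (x, y) stands for
    z = x + iy, i.e. z_j = x_j + i y_j. *)
Definition cspace (R : realType) (n : nat) : normedModType R :=
  ('cV[R]_n * 'cV[R]_n)%type.

(** t^k = i R^k: the column v stands for the element i v, so the standard inner
    product of t^k is the dot product below. *)
Definition tlie (R : realType) (k : nat) : normedModType R := 'cV[R]_k.

(** The ambient space of pairs (z, eta), z : R -> C^n being a loop once it is
    1-periodic (S^1 = R/Z). *)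
Definition config (R : realType) (n k : nat) : lmodType R :=
  ((R -> cspace R n) * tlie R k)%type.

Section Definitions.
Context {R : realType}.

Definition dot (m : nat) (v w : 'cV[R]_m) : R := \sum_(i < m) v i 0 * w i 0.

Definition cdot (n : nat) (z w : cspace R n) : R := dot z.1 w.1 + dot z.2 w.2.

Definition ccoord (n : nat) (z : cspace R n) (j : 'I_n) : R[i] :=
  (z.1 j 0 +i* z.2 j 0)%C.

Definition smooth (V : normedModType R) (f : R -> V) : Prop :=
  forall (m : nat) (t : R), derivable (derive1n m f) t 1.

(** Iterated partial derivatives of F(s, t), indexed by words: [true] is d/ds and
    [false] is d/dt, the head of the word being applied last. *)
Fixpoint pderiv (V : normedModType R) (w : seq bool) (F : R -> R -> V) :
    R -> R -> V :=
  match w with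
  | [::] => F
  | true :: w' => fun s t => derive1 (fun s' => pderiv w' F s' t) s
  | false :: w' => fun s t => derive1 (pderiv w' F s) t
  end.

Definition smooth2 (V : normedModType R) (F : R -> R -> V) : Prop :=
  forall w : seq bool,
    [/\ forall s t, derivable (fun s' => pderiv w F s' t) s 1,
        forall s t, derivable (pderiv w F s) t 1
      & continuous (fun p : R * R => pderiv w F p.1 p.2)].

Definition loops (n : nat) : set (R -> cspace R n) :=
  [set z | smooth z /\ forall t, z (t + 1) = z t].

Definition L0 (n k : nat) : set (config R n k) := @loops n `*` setT.

(** y = (z, eta) is smooth as an element of C^oo(R x S^1, C^n) x C^oo(R, t^k), which
    requires joint smoothness in (s, t). *)
Definition smooth_path (n k : nat) (y : R -> config R n k) : Prop :=
  [/\ smooth2 (fun s t => (y s).1 t),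
      forall s t, (y s).1 (t + 1) = (y s).1 t
    & smooth (fun s => (y s).2)].

Definition path_deriv (n k : nat) (y : R -> config R n k) (s : R) :
    config R n k :=
  (fun t => derive1 (fun s' => (y s').1 t) s, derive1 (fun s' => (y s').2) s).

(** Convergence in L0 for the C^oo-topology: uniform convergence of all
    t-derivatives of the loops (uniformity over a period and over R agree), and
    convergence in t^k. *)
Definition cvg_L0 (n k : nat) (y : R -> config R n k) (F : set_system R)
    (p : config R n k) : Prop :=
  (forall m : nat, {uniform, (fun s => derive1n m (y s).1) @ F --> derive1n m p.1}) /\
  (fun s => (y s).2) @ F --> p.2.

Section Moment.
Context {n k : nat} (A : 'M[int]_(n, k)).

(** The moment map; with t^k identified with R^k the factor i disappears. *)
Definition moment (z : cspace R n) : tlie R k :=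
  2^-1 *: ((map_mx (fun a : int => a%:~R : R) A)^T
           *m \col_(j < n) (z.1 j 0 ^+ 2 + z.2 j 0 ^+ 2)).

Definition proper_map (V W : topologicalType) (f : V -> W) : Prop :=
  continuous f /\ forall K : set W, compact K -> compact (f @^-1` K).

Definition regular_value (V W : normedModType R) (f : V -> W) (c : W) : Prop :=
  forall z, f z = c -> forall u : W, exists v : V, 'd f z v = u.

(** The 1-form sum_j y_j dx_j at the point z, applied to the tangent vector v. *)
Definition lambda (z v : cspace R n) : R := dot z.2 v.1.

Definition action0 (tau : tlie R k) (p : config R n k) : R :=
  (\int[lebesgue_measure]_(t in `[0, 1]) lambda (p.1 t) (derive1 p.1 t))
  + dot p.2
      ((\col_(r < k) \int[lebesgue_measure]_(t in `[0, 1]) moment (p.1 t) r 0)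
       - tau).

Definition g0 (v w : config R n k) : R :=
  (\int[lebesgue_measure]_(t in `[0, 1]) cdot (v.1 t) (w.1 t)) + dot v.2 w.2.

(** The gradient is characterized by  df(p) w = g0(v, w)  for all w in L0; L0 being a
    vector space, df(p) w is the derivative of f along the line p + e w. *)
Definition is_gradient (f : config R n k -> R) (p v : config R n k) : Prop :=
  L0 v /\
  forall w, L0 w -> is_derive (0 : R) 1 (fun e : R => f (p + e *: w)) (g0 v w).

Definition gradient_flow (tau : tlie R k) (y : R -> config R n k) : Prop :=
  forall s, exists v,
    is_gradient (action0 tau) (y s) v /\ path_deriv y s + v = 0.

End Moment.

Definition expi (x : R) : R[i] := (cos x +i* sin x)%C.

(** The space V of loops with z_j(t) = sum_(mm j <= m <= mp j) c_jm exp(2 pi i m t);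
    the sum over integers is indexed by m = mm j + l with 0 <= l <= mp j - mm j. *)
Definition trig_loops (n : nat) (mm mp : 'I_n -> int) : set (R -> cspace R n) :=
  [set z | exists c : 'I_n -> int -> R[i], forall (t : R) (j : 'I_n),
     ccoord (z t) j =
     \sum_(l < `|mp j - mm j|%N.+1)
       c j (mm j + l%:Z) * expi (2 * pi * (mm j + l%:Z)%:~R * t)].

End Definitions.

(* Main.v *)
Require Import Defs.
From mathcomp Require Import all_boot all_order all_algebra.
From mathcomp Require Import complex.
From mathcomp Require Import all_classical all_reals all_analysis.
From mathcomp Require Import ring lra zify.
Set Implicit Arguments.
Unset Strict Implicit.
Unset Printing Implicit Defensive.
Import Order.TTheory GRing.Theory Num.Theory numFieldNormedType.Exports.
Local Open Scope classical_set_scope.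
Local Open Scope ring_scope.

(** The gradient of the action in the direction of the loops is
    i dz_j/dt + (A eta)_j z_j, so along a flow line the m-th Fourier coefficient
    c_jm(s) of the j-th coordinate satisfies the scalar equation
      c_jm'(s) = (2 pi m - (A eta(s))_j) c_jm(s)
    ([loop_coef_flow]).  Because eta converges at both ends, the functions
    (A eta)_j are bounded ([weight_bounded]); hence for |m| large the factor
    2 pi m - (A eta)_j is at least 1 or at most -1 for all s, and a nonzero
    solution is unbounded at +oo or at -oo respectively.  As the loops converge
    uniformly at both ends, the coefficients are bounded there, so they vanish
    for all |m| > M_j ([loop_coef_eq0]).

    The equation for c_jm is obtained from the definition of the gradient by
    testing against the loops exp(i phi) exp(2 pi i m t) e_j only: along these
    lines the action is a quadratic polynomial whose linear coefficient is
    computed by integration by parts ([is_derive_action0],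
    [first_variation_mode]), and the left-hand side is the derivative of an
    integral with a parameter ([is_derive_mean]).

    It remains to see that a continuous periodic loop with finitely many nonzero
    Fourier coefficients is a trigonometric polynomial ([trig_poly_of_coef]).
    This reduces to the uniqueness theorem for Fourier coefficients
    ([fourier_uniqueness]): a continuous function f orthogonal to all
    trigonometric polynomials is orthogonal to the kernels cos(pi (t - t0))^(2N),
    which concentrate at t0, so f(t0) = 0. *)

(** * Means of continuous functions over one period *)

Section ContinuousCalculus.
Context {R : realType}.
Implicit Types (f g : R -> R).

Lemma derivable_cts {V : normedModType R} (f : R -> V) :
  (forall t, derivable f t 1) -> continuous f.
Proof.
by move=> df t; apply: differentiable_continuous; exact/derivable1_diffP.
Qed.

Lemma cts_cst {T : topologicalType} (c : R) : continuous (fun _ : T => c).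
Proof. by move=> x; exact: cvg_cst. Qed.

Lemma cts_id : continuous (fun x : R => x).
Proof. by move=> x; exact: cvg_id. Qed.

Lemma ctsD {T : topologicalType} (f g : T -> R) :
  continuous f -> continuous g -> continuous (fun x => f x + g x).
Proof. by move=> cf cg x; apply: cvgD; [exact: cf|exact: cg]. Qed.

Lemma ctsN {T : topologicalType} (f : T -> R) :
  continuous f -> continuous (fun x => - f x).
Proof. by move=> cf x; apply: cvgN; exact: cf. Qed.

Lemma ctsM {T : topologicalType} (f g : T -> R) :
  continuous f -> continuous g -> continuous (fun x => f x * g x).
Proof. by move=> cf cg x; apply: cvgM; [exact: cf|exact: cg]. Qed.

Lemma ctsX f n : continuous f -> continuous (fun x => f x ^+ n).
Proof. by move=> cf x; apply: (@continuous_comp _ _ _ f (fun y => y ^+ n));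
  [exact: cf|exact: exprn_continuous]. Qed.

Lemma cts_norm f : continuous f -> continuous (fun x => `|f x|).
Proof. by move=> cf x; apply: cvg_norm; exact: cf. Qed.

Lemma cts_cos f : continuous f -> continuous (fun x => cos (f x)).
Proof. by move=> cf x; apply: (@continuous_comp _ _ _ f cos);
  [exact: cf|exact: continuous_cos]. Qed.

Lemma cts_sin f : continuous f -> continuous (fun x => sin (f x)).
Proof. by move=> cf x; apply: (@continuous_comp _ _ _ f sin);
  [exact: cf|exact: continuous_sin]. Qed.

Lemma cts_sum {T : topologicalType} (I : Type) (r : seq I) (F : I -> T -> R) :
  (forall i, continuous (F i)) -> continuous (fun x => \sum_(i <- r) F i x).
Proof.
move=> cF; elim: r => [|i r IH].
  by under eq_fun do rewrite big_nil; exact: cts_cst.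
by under eq_fun do rewrite big_cons; exact: ctsD.
Qed.

End ContinuousCalculus.

Create HintDb cts.

Ltac cts_leaf := first [assumption | solve [auto 2 with cts nocore]].

Ltac cts :=
  lazymatch goal with
  | |- is_true _ => idtac
  | |- forall x, continuous_at x ?F =>
    lazymatch F with
    | fun _ => ?c => apply: cts_cst
    | fun x => x => apply: cts_id
    | fun x => @GRing.add _ (@?f x) (@?g x) => apply: (@ctsD _ _ f g); cts
    | fun x => @GRing.opp _ (@?f x) => apply: (@ctsN _ _ f); cts
    | fun x => @GRing.mul _ (@?f x) (@?g x) => apply: (@ctsM _ _ f g); cts
    | fun x => @GRing.exp _ (@?f x) _ => apply: (@ctsX _ f); cts
    | fun x => cos (@?f x) => apply: (@cts_cos _ f); cts
    | fun x => sin (@?f x) => apply: (@cts_sin _ f); cts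
    | fun x => `|@?f x| => apply: (@cts_norm _ f); cts
    | fun x => \sum_(i <- _) (@?f i x) => apply: (@cts_sum _ _ _ _ f) => ?; cts
    | _ => try cts_leaf
    end
  | |- _ => idtac
  end.

Section Mean.
Context {R : realType}.
Implicit Types (f g : R -> R).

Definition mean f : R := \int[lebesgue_measure]_(t in `[0, 1]) f t.

Lemma eq_mean f g : (forall t, f t = g t) -> mean f = mean g.
Proof. by move=> fg; congr mean; apply/funext. Qed.

Lemma integrable01 {f} : continuous f ->
  (@lebesgue_measure R).-integrable `[0, 1] (EFin \o f).
Proof.
move=> cf; apply: continuous_compact_integrable; first exact: segment_compact.
exact: continuous_subspaceT.
Qed.

Lemma meanD f g : continuous f -> continuous g ->
  mean (fun t => f t + g t) = mean f + mean g.
Proof. by move=> cf cg; apply: RintegralD; rewrite //; exact: integrable01. Qed.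

Lemma meanB f g : continuous f -> continuous g ->
  mean (fun t => f t - g t) = mean f - mean g.
Proof. by move=> cf cg; apply: RintegralB; rewrite //; exact: integrable01. Qed.

Lemma meanZ f (a : R) : continuous f -> mean (fun t => a * f t) = a * mean f.
Proof. by move=> cf; apply: RintegralZl; rewrite //; exact: integrable01. Qed.

Lemma mean_cst (a : R) : mean (fun _ => a) = a.
Proof.
rewrite /mean Rintegral_cst//= lebesgue_measure_itv/= lte01.
by rewrite /= subr0 mulr1.
Qed.

Lemma le_mean f g : continuous f -> continuous g ->
  (forall t, 0 <= t <= 1 -> f t <= g t) -> mean f <= mean g.
Proof.
move=> cf cg fg; by apply: le_Rintegral => //; exact: integrable01.
Qed.

Lemma le_norm_mean f : continuous f -> `|mean f| <= mean (fun t => `|f t|).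
Proof. by move=> cf; apply: le_normr_Rintegral => //; exact: integrable01. Qed.

Lemma mean_derive f F : continuous f ->
  (forall t, is_derive t (1 : R) F (f t)) -> mean f = F 1 - F 0.
Proof.
move=> cf dF.
have cF : continuous F by apply: derivable_cts => t; case: (dF t).
rewrite /mean /Rintegral (@continuous_FTC2 _ f F 0 1)//.
- exact: continuous_subspaceT.
- split.
  + by move=> t _; exact: (@ex_derive _ _ _ _ _ _ _ (dF t)).
  + exact/cvg_at_right_filter/cF.
  + exact/cvg_at_left_filter/cF.
- by move=> t _; rewrite derive1E; exact: (@derive_val _ _ _ _ _ _ _ (dF t)).
Qed.

End Mean.

(** * Pointwise derivatives *)

Section PointwiseDerivatives.
Context {R : realType}.
Implicit Types (f g : R -> R).

Lemma der_affine (a b t : R) : is_derive t (1 : R) (fun x => a * x + b) a.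
Proof.
have h : is_derive t (1 : R) ((a \*: (@id R)) + cst b) (a *: (1 : R) + 0).
  exact: is_deriveD.
by rewrite addr0 scaler1 in h.
Qed.

Lemma derM f g (t a b : R) : is_derive t (1 : R) f a -> is_derive t (1 : R) g b ->
  is_derive t (1 : R) (fun x => f x * g x) (a * g t + f t * b).
Proof.
move=> df dg; apply: (is_derive_eq (@is_deriveM _ _ f g t 1 a b df dg)).
by rewrite addrC /GRing.scale/= [g t * a]mulrC.
Qed.

Lemma der_cos f (t a : R) : is_derive t (1 : R) f a ->
  is_derive t (1 : R) (fun x => cos (f x)) (- sin (f t) * a).
Proof. by move=> df; apply: (@is_derive1_comp _ cos f). Qed.

Lemma der_sin f (t a : R) : is_derive t (1 : R) f a ->
  is_derive t (1 : R) (fun x => sin (f x)) (cos (f t) * a).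
Proof. by move=> df; apply: (@is_derive1_comp _ sin f). Qed.

Lemma derX f n (t a : R) : is_derive t (1 : R) f a ->
  is_derive t (1 : R) (fun x => f x ^+ n) (n%:R * f t ^+ n.-1 * a).
Proof.
move=> df; rewrite (_ : (fun x => _) = f ^+ n); last first.
  by apply/funext => x; rewrite fctE.
apply: (is_derive_eq (@is_deriveX _ _ f n t 1 a df)).
by rewrite /GRing.scale/= mulr_natl.
Qed.

End PointwiseDerivatives.

(** * Uniqueness of Fourier coefficients *)

Section FourierUniqueness.
Context {R : realType}.
Implicit Types (f : R -> R).

Definition phase (m : int) (phi t : R) : R := 2 * pi * m%:~R * t + phi.

Lemma cts_phase m phi : continuous (phase m phi).
Proof. by rewrite /phase; cts. Qed.
#[local] Hint Resolve cts_phase : cts.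

(** The square of the cosine is nonnegative, has period 1 in [t] although the
    cosine itself only has period 2, and equals 1 exactly at [t0] modulo 1; its
    powers are the trigonometric polynomials that concentrate at [t0]. *)
Definition kernel (t0 t : R) : R := cos (pi * (t - t0)) ^+ 2.

Lemma cts_kernel t0 : continuous (kernel t0).
Proof. by rewrite /kernel; cts. Qed.
#[local] Hint Resolve cts_kernel : cts.

Lemma kernel_ge0 t0 t : 0 <= kernel t0 t. Proof. exact: sqr_ge0. Qed.

Lemma kernel_le1 t0 t : 0 <= 1 - kernel t0 t.
Proof. by rewrite /kernel -sin2cos2 sqr_ge0. Qed.

Definition fourier_null f :=
  forall m phi, mean (fun t => f t * cos (phase m phi t)) = 0.

(** Allowing every phase [phi] puts cosines and sines in one family, which is
    closed under multiplication by a phase-shifted cosine: the product formula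
    sends the mode [m] to [m + 1] and [m - 1] with new phases.  The kernel is
    1/2 plus half of such a cosine. *)
Lemma fourier_null_kernel f t0 : continuous f -> fourier_null f ->
  fourier_null (fun t => f t * kernel t0 t).
Proof.
move=> cf f0 m phi.
have -> : (fun t => f t * kernel t0 t * cos (phase m phi t)) =
   (fun t => 2^-1 * (f t * cos (phase m phi t)) +
     (4^-1 * (f t * cos (phase (m + 1) (phi - 2 * pi * t0) t)) +
      4^-1 * (f t * cos (phase (m - 1) (phi + 2 * pi * t0) t)))).
  apply/funext => t; rewrite /kernel; set a := pi * (t - t0).
  have -> : phase (m + 1) (phi - 2 * pi * t0) t = phase m phi t + a *+ 2.
    by rewrite /phase /a intrD; ring.
  have -> : phase (m - 1) (phi + 2 * pi * t0) t = phase m phi t - a *+ 2.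
    by rewrite /phase /a intrB; ring.
  by rewrite cosD cosB cos_mulr2n; field.
by rewrite !meanD ?meanZ ?f0; cts; rewrite ?mulr0 ?addr0.
Qed.

Lemma mean_kernel_null f t0 N : continuous f -> fourier_null f ->
  mean (fun t => f t * kernel t0 t ^+ N) = 0.
Proof.
move=> cf f0.
have [_ null] : continuous (fun t => f t * kernel t0 t ^+ N) /\
    fourier_null (fun t => f t * kernel t0 t ^+ N).
  elim: N => [|N [cN IH]].
    by under eq_fun do rewrite expr0 mulr1.
  under eq_fun do rewrite exprSr mulrA.
  split; first by cts.
  exact: fourier_null_kernel.
have := null 0 0; congr (_ = _); apply: eq_mean => t.
by rewrite /phase mulr0 mul0r addr0 cos0 mulr1.
Qed.

(** Integrate over one period the derivative of the periodic function
    sin(a) cos(a)^(2N+1) / pi, where a = pi (t - t0).  This is the quantitative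
    form of the concentration of the kernel at [t0]: the weight [1 - kernel]
    makes its mean smaller by a factor of order 1/N. *)
Lemma mean_kernel_rec t0 N :
  mean (fun t => kernel t0 t ^+ N.+1) =
  (N.*2.+1)%:R * mean (fun t => (1 - kernel t0 t) * kernel t0 t ^+ N).
Proof.
apply/eqP; rewrite -subr_eq0 -meanZ; last by cts.
rewrite -meanB; [|by cts|by cts].
pose a t := pi * t + - (pi * t0) : R.
pose F t := pi^-1 * (sin (a t) * cos (a t) ^+ N.*2.+1).
rewrite [mean _](_ : _ = F 1 - F 0); last first.
  apply: mean_derive => [|t]; first by cts.
  have da : is_derive t (1 : R) a pi by exact: der_affine.
  have d := derM (der_sin da) (derX N.*2.+1 (der_cos da)).
  apply: (is_derive_eq (derM (is_derive_cst (pi^-1 : R) t (1 : R)) d)).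
  have -> : kernel t0 t = cos (a t) ^+ 2 by rewrite /kernel /a mulrBr.
  rewrite -sin2cos2 -!exprM /=.
  have -> : (2 * N.+1)%N = N.*2.+2 by rewrite -mul2n mulnS.
  rewrite mul2n !exprS.
  have p0 : pi != 0 :> R by rewrite gt_eqF// pi_gt0.
  rewrite /cst; move: (cos (a t) ^+ _) (N.*2.+1%:R) => X k.
  move: (sin (a t)) (cos (a t)) p0; move: (@pi R) => p x y p0.
  by field.
have -> : F 1 = F 0.
  rewrite /F /a mulr0 add0r mulr1; congr (_ * _).
  rewrite addrC sinDpi cosDpi exprNn -signr_odd/= odd_double/= expr1.
  by ring.
by rewrite subrr.
Qed.

Lemma mean_kernel_gt0 t0 N : 0 < mean (fun t => kernel t0 t ^+ N).
Proof.
elim: N => [|N IH].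
  by under eq_mean do rewrite expr0; rewrite mean_cst.
have := mean_kernel_rec t0 N.
under [X in _ = _ * X]eq_mean do rewrite mulrBl mul1r -exprS.
rewrite meanB; [|by cts|by cts].
move: IH; set u := mean _; set v := mean _ => u0 vE.
have n0 : (0 : R) <= N.*2%:R by rewrite ler0n.
rewrite -addn1 natrD in vE.
nra.
Qed.

(** Near [t0] the continuity of [f] gives the bound [e]; on the compact rest of
    the period [1 - kernel] has a positive minimum, so a multiple of it
    dominates.  For 0 < t0 < 1 the only zero of [1 - kernel] in [0, 1] is
    [t0]; at t0 = 0 or 1 both endpoints would be zeros. *)
Lemma kernel_separates f t0 (e : R) : continuous f -> 0 < t0 < 1 -> 0 < e ->
  exists2 C : R, 0 <= C & forall t, 0 <= t <= 1 ->
    `|f t0 - f t| <= e + C * (1 - kernel t0 t).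
Proof.
move=> cf t01 e0.
have /cvgrPdist_lt/(_ e e0) := cf t0.
rewrite near_nbhs => -[d /= d0 fd].
pose A := `[0, 1] `&` ~` (ball t0 d).
have cA : compact A.
  apply: compact_closedI; first exact: segment_compact.
  by rewrite closedC; exact: ball_open.
have near_far t : 0 <= t <= 1 -> ~ A t -> `|f t0 - f t| <= e.
  move=> t1 nA; apply/ltW/fd; apply: contrapT => nb; apply: nA.
  by split=> //=; rewrite in_itv.
have [A0|A0] := pselect (A !=set0); last first.
  exists 0 => // t t1; rewrite mul0r addr0; apply: near_far => // At.
  by apply: A0; exists t.
have cd : continuous (fun t => `|f t0 - f t|) by cts.
have ck : continuous (fun t => 1 - kernel t0 t) by cts.
have [a aA maxa] := compact_EVT_max A0 cA (continuous_subspaceT cd).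
have [b bA minb] := compact_EVT_min A0 cA (continuous_subspaceT ck).
have b_gt0 : 0 < 1 - kernel t0 b.
  rewrite lt_neqAle kernel_le1 andbT eq_sym /kernel -sin2cos2 sqrf_eq0.
  move: bA; rewrite inE => -[/=]; rewrite in_itv/= => b1 nb.
  have bt0 : b != t0 by apply: contra_notN nb => /eqP ->; exact: ballxx.
  have p0 := @pi_gt0 R.
  have [lt|lt|eq] := ltgtP t0 b; last by rewrite eq eqxx in bt0.
    by rewrite gt_eqF// sin_gt0_pi//; apply/andP; split; nra.
  rewrite -[_ * _]opprK sinN oppr_eq0 gt_eqF// sin_gt0_pi//.
  by apply/andP; split; nra.
exists (`|f t0 - f a| / (1 - kernel t0 b)) => [|t t1].
  by rewrite divr_ge0// kernel_le1.
have [At|nA] := pselect (A t); last first.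
  apply: (le_trans (near_far _ t1 nA)).
  by rewrite lerDl mulr_ge0 ?divr_ge0 ?kernel_le1.
have /maxa fa : t \in A by rewrite inE.
have /minb fb : t \in A by rewrite inE.
apply: (le_trans fa); rewrite -[leLHS]add0r; apply: lerD; first exact: ltW.
by rewrite mulrAC -mulrA ler_peMr// ler_pdivlMr// mul1r.
Qed.

(** The mean of [f * kernel ^+ N] vanishes, so |f(t0)| times the mean of
    [kernel ^+ N] is at most the mean of |f(t0) - f| against the same weight;
    [kernel_separates] and [mean_kernel_rec] bound the quotient by
    e/2 + C/(2N+1), hence by e for large N. *)
Lemma fourier_uniqueness f : continuous f -> fourier_null f ->
  forall t0, 0 < t0 < 1 -> f t0 = 0.
Proof.
move=> cf f0 t0 t01; apply/eqP; rewrite -normr_le0.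
apply/ler_addgt0Pl => e e0; rewrite addr0.
have e20 : 0 < e / 2 by rewrite divr_gt0.
have [C C0 fC] := kernel_separates cf t01 e20.
pose N := Num.Def.archi_bound (C / e).
have CN : C / e < N%:R by rewrite Num.Theory.archi_boundP// divr_ge0// ltW.
have I0 := mean_kernel_gt0 t0 N; have I1 := mean_kernel_gt0 t0 N.+1.
have rec := mean_kernel_rec t0 N.
set I := mean (fun t => kernel t0 t ^+ N) in I0.
set J := mean (fun t => (1 - kernel t0 t) * kernel t0 t ^+ N) in rec.
have JE : J = I - mean (fun t => kernel t0 t ^+ N.+1).
  rewrite /I -meanB; [|by cts|by cts].
  by apply: eq_mean => t; rewrite mulrBl mul1r -exprS.
have le1 : `|f t0| * I <= e / 2 * I + C * J.
  have -> : `|f t0| * I = `|mean (fun t => (f t0 - f t) * kernel t0 t ^+ N)|.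
    under [mean (fun t => (f t0 - f t) * _)]eq_mean do rewrite mulrBl.
    rewrite meanB; [|by cts|by cts].
    rewrite (mean_kernel_null t0 N cf f0) subr0 meanZ; last by cts.
    by rewrite normrM (gtr0_norm I0).
  apply: le_trans (le_norm_mean _) _; first by cts.
  rewrite -!meanZ; [|by cts|by cts]; rewrite -meanD; [|by cts|by cts].
  apply: le_mean; [by cts|by cts|] => t t1.
  rewrite normrM mulrA -mulrDl.
  have kN : 0 <= kernel t0 t ^+ N by rewrite exprn_ge0 ?kernel_ge0.
  by rewrite (ger0_norm kN) ler_wpM2r// fC.
have CJ : C * J <= e / 2 * I.
  have : C < N%:R * e by rewrite -ltr_pdivrMr.
  rewrite rec in JE I1.
  move: JE I1; rewrite -addn1 -muln2 natrD natrM.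
  move: (N%:R) => n JE I1 Cn.
  have J0 : 0 <= J.
    apply: Rintegral_ge0 => t _; apply: mulr_ge0; first exact: kernel_le1.
    exact/exprn_ge0/kernel_ge0.
  have CJ : C * J <= n * e * J by rewrite ler_wpM2r// ltW.
  nra.
rewrite -(ler_pM2r I0); lra.
Qed.

End FourierUniqueness.

#[local] Hint Resolve cts_phase : cts.

Section Periodic.

Lemma periodicz {U V : zmodType} (f : U -> V) (T : U) :
  periodic f T -> forall (k : int) a, f (a + T *~ k) = f a.
Proof.
move=> fT [n|n] a; first by rewrite -pmulrn (periodicn fT).
by rewrite NegzE mulrNz -pmulrn -[in RHS](subrK (T *+ n.+1) a) (periodicn fT).
Qed.

Context {R : realType}.

(** A translation by an integer leads to [0, 1[, and the point 0 is a limit of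
    interior points. *)
Lemma fourier_uniqueness_periodic (f : R -> R) : continuous f ->
  (forall t, f (t + 1) = f t) -> fourier_null f -> forall t, f t = 0.
Proof.
move=> cf pf f0 t; have f01 := fourier_uniqueness cf f0.
rewrite -(subrK (Num.floor t)%:~R t) (periodicz (T := 1) pf).
have ge0 : 0 <= t - (Num.floor t)%:~R by rewrite subr_ge0 floor_le_tmp.
have lt1 : t - (Num.floor t)%:~R < 1.
  by rewrite ltrBlDl -[X in _ + X]/(1%:~R) -intrD floorD1_gt.
move: ge0; rewrite le_eqVlt => /predU1P[<-|gt0]; last by apply/f01/andP.
have lim_f : f x @[x --> (0 : R)^'+] --> f 0 by exact/cvg_at_right_filter/cf.
have lim_0 : f x @[x --> (0 : R)^'+] --> (0 : R).
  apply: (@cvg_trans _ (cst 0 x @[x --> (0 : R)^'+])); last exact: cvg_cst.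
  apply: near_eq_cvg; near=> x; rewrite /cst f01//; apply/andP; split.
    by near: x; exact: nbhs_right_gt.
  by near: x; exact: nbhs_right_lt.
exact: (cvg_unique _ lim_f lim_0).
Unshelve. all: end_near. Qed.

Lemma phaseD1 m phi (t : R) : phase m phi (t + 1) = phase m phi t + (pi *+ 2) *~ m.
Proof. by rewrite /phase -[X in _ = _ + X]mulrzr; ring. Qed.

Lemma cos_phaseD1 m phi (t : R) : cos (phase m phi (t + 1)) = cos (phase m phi t).
Proof. by rewrite phaseD1 (periodicz (@cosD2pi R)). Qed.

Lemma sin_phaseD1 m phi (t : R) : sin (phase m phi (t + 1)) = sin (phase m phi t).
Proof. by rewrite phaseD1 (periodicz (@sinD2pi R)). Qed.

Lemma der_phase m phi (t : R) :
  is_derive t (1 : R) (phase m phi) (2 * pi * m%:~R).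
Proof. exact: der_affine. Qed.

Lemma mean_cos_phase m (phi : R) :
  mean (fun t => cos (phase m phi t)) = (m == 0)%:R * cos phi.
Proof.
have [->|m0] := eqVneq m 0.
  rewrite -[RHS]mean_cst; apply: eq_mean => t.
  by rewrite /phase mulr0 mul0r add0r mul1r.
have w0 : 2 * pi * m%:~R != 0 :> R.
  by rewrite !mulf_eq0 pnatr_eq0 intr_eq0 (negbTE m0) orbF/= lt0r_neq0// pi_gt0.
rewrite mul0r; pose F (t : R) := (2 * pi * m%:~R)^-1 * sin (phase m phi t).
have -> : mean (fun t => cos (phase m phi t)) = F 1 - F 0.
  apply: mean_derive => [|t]; first by cts.
  have d := der_sin (der_phase m phi t).
  apply: (is_derive_eq (derM (is_derive_cst _ t (1 : R)) d)).
  by rewrite mul0r add0r /cst mulrCA mulVf ?mulr1.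
by rewrite /F; have := sin_phaseD1 m phi 0; rewrite add0r => ->; rewrite subrr.
Qed.

Lemma phase_pihalf m (phi t : R) : phase m (phi + pi / 2) t = phase m phi t + pi / 2.
Proof. by rewrite /phase addrA. Qed.

Lemma mean_sin_phase m (phi : R) :
  mean (fun t => sin (phase m phi t)) = (m == 0)%:R * sin phi.
Proof.
rewrite -[sin phi]cosBpihalf -mean_cos_phase; apply: eq_mean => t.
by rewrite -cosBpihalf /phase addrA.
Qed.

End Periodic.

(** * Loops with finitely many Fourier modes *)

Section FourierCoefficients.
Context {R : realType}.
Implicit Types (x y : R -> R).

(** For z = x + iy with m-th Fourier coefficient c, this is the real part of
    exp(-i phi) c.  So the phases 0 and pi/2 give the real and the imaginary part
    of c, and c = 0 means that all phases give 0. *)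
Definition coef x y (m : int) (phi : R) : R :=
  mean (fun t => x t * cos (phase m phi t) + y t * sin (phase m phi t)).

(** This is Re(exp(-i phi) c) = cos(phi) Re(c) + sin(phi) Im(c). *)
Lemma coef_phase x y m phi : continuous x -> continuous y ->
  coef x y m phi = cos phi * coef x y m 0 + sin phi * coef x y m (pi / 2).
Proof.
move=> cx cy; rewrite /coef -!meanZ; cts; rewrite -meanD; cts.
apply: eq_mean => t; rewrite -[pi / 2]add0r phase_pihalf cosDpihalf sinDpihalf.
by rewrite /phase addr0 cosD sinD; ring.
Qed.

Lemma coefD x y x' y' m phi : continuous x -> continuous y ->
  continuous x' -> continuous y' ->
  coef (fun t => x t + x' t) (fun t => y t + y' t) m phi =
  coef x y m phi + coef x' y' m phi.
Proof.
move=> cx cy cx' cy'; rewrite /coef -meanD; cts.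
by apply: eq_mean => t; ring.
Qed.

Lemma coefB x y x' y' m phi : continuous x -> continuous y ->
  continuous x' -> continuous y' ->
  coef (fun t => x t - x' t) (fun t => y t - y' t) m phi =
  coef x y m phi - coef x' y' m phi.
Proof.
move=> cx cy cx' cy'; rewrite /coef -meanB; cts.
by apply: eq_mean => t; ring.
Qed.

(** Orthogonality of the exponentials, for the loop (a + ib) exp(2 pi i l t). *)
Lemma coef_mode (a b : R) l m phi :
  coef (fun t => a * cos (phase l 0 t) - b * sin (phase l 0 t))
       (fun t => a * sin (phase l 0 t) + b * cos (phase l 0 t)) m phi =
  (l == m)%:R * (a * cos phi + b * sin phi).
Proof.
have -> : (l == m) = (m - l == 0) by rewrite subr_eq0 eq_sym.
transitivity (a * mean (fun t => cos (phase (m - l) phi t)) +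
              b * mean (fun t => sin (phase (m - l) phi t))); last first.
  by rewrite mean_cos_phase mean_sin_phase; ring.
rewrite /coef -!meanZ; cts; rewrite -meanD; cts.
apply: eq_mean => t.
have -> : phase (m - l) phi t = phase m phi t - phase l 0 t.
  by rewrite /phase intrB; ring.
by rewrite cosB sinB; ring.
Qed.

(** The m-th coefficient at phase [phi] and the (-m)-th at phase [- phi] have
    the same cosine and opposite sines; adding them isolates [x]. *)
Lemma coef_null x y : continuous x -> continuous y ->
  (forall m phi, coef x y m phi = 0) -> fourier_null x /\ fourier_null y.
Proof.
move=> cx cy c0.
have nphase m phi t : phase (- m) (- phi) t = - phase m phi t.
  by rewrite /phase mulrNz; ring.
have nx : fourier_null x.
  move=> m phi; have := c0 m phi; have := c0 (- m) (- phi).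
  rewrite /coef; under eq_mean do rewrite nphase cosN sinN mulrN.
  rewrite meanB; cts; rewrite meanD; cts; lra.
split=> // m phi; have := c0 m (phi + pi / 2).
rewrite /coef meanD; cts; rewrite nx add0r => <-; apply: eq_mean => t.
by rewrite phase_pihalf sinDpihalf.
Qed.

(** Subtracting the partial Fourier sum over |m| <= M leaves a loop all of whose
    coefficients vanish, and such a loop is zero. *)
Lemma trig_poly_of_coef x y (M : nat) : continuous x -> continuous y ->
  (forall t, x (t + 1) = x t) -> (forall t, y (t + 1) = y t) ->
  (forall m phi, (M < `|m|)%N -> coef x y m phi = 0) ->
  forall t, (x t +i* y t)%C =
    \sum_(l < (M.*2).+1) (coef x y (- M%:Z + l%:Z) 0 +i* coef x y (- M%:Z + l%:Z) (pi / 2))%C *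
       expi (2 * pi * (- M%:Z + l%:Z)%:~R * t).
Proof.
move=> cx cy px py c0.
pose mode (l : nat) : int := - M%:Z + l%:Z.
pose C l := coef x y (mode l) 0; pose S l := coef x y (mode l) (pi / 2).
pose F l t := C l * cos (phase (mode l) 0 t) - S l * sin (phase (mode l) 0 t).
pose G l t := C l * sin (phase (mode l) 0 t) + S l * cos (phase (mode l) 0 t).
have cF l : continuous (F l) by rewrite /F; cts.
have cG l : continuous (G l) by rewrite /G; cts.
pose PF N t := \sum_(l < N) F l t; pose PG N t := \sum_(l < N) G l t.
have cPF N : continuous (PF N) by apply: cts_sum.
have cPG N : continuous (PG N) by apply: cts_sum.
have coefP N m phi : coef (PF N) (PG N) m phi =
    \sum_(l < N) (mode l == m)%:R * (C l * cos phi + S l * sin phi).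
  elim: N => [|N IH].
    rewrite big_ord0 /coef /PF /PG; under eq_mean do rewrite !big_ord0 !mul0r addr0.
    exact: mean_cst.
  rewrite big_ord_recr/= -IH -coef_mode -coefD//; try by cts.
  by congr coef; apply/funext => t; rewrite /PF /PG big_ord_recr.
pose K := M.*2.+1.
have null m phi : coef (fun t => x t - PF K t) (fun t => y t - PG K t) m phi = 0.
  rewrite coefB// coefP; apply/eqP; rewrite subr_eq0; apply/eqP.
  have [Mm|mM] := ltnP M `|m|%N.
    rewrite c0// big1// => l _; case: eqP => [lm|]; last by rewrite mul0r.
    by have := ltn_ord l; move: Mm; rewrite -lm /mode /K; lia.
  have lN : (`|(m + M%:Z)%R| < K)%N by rewrite /K; lia.
  rewrite (bigD1 (Ordinal lN))//= big1 ?addr0 => [|l lm]; last first.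
    case: eqP => [e|]; last by rewrite mul0r.
    by case/eqP: lm; apply/val_inj => /=; rewrite -e /mode; lia.
  rewrite /C /S; have -> : mode `|(m + M%:Z)%R|%N = m by rewrite /mode; lia.
  by rewrite eqxx mul1r coef_phase//; ring.
have [nx ny] := coef_null (ctsD cx (ctsN (cPF K))) (ctsD cy (ctsN (cPG K))) null.
move=> t; have perF l s : F l (s + 1) = F l s.
  by rewrite /F cos_phaseD1 sin_phaseD1.
have perG l s : G l (s + 1) = G l s.
  by rewrite /G cos_phaseD1 sin_phaseD1.
have xE : x t = PF K t.
  apply/eqP; rewrite -subr_eq0; apply/eqP.
  apply: (fourier_uniqueness_periodic (f := fun t => x t - PF K t)) => // [|s].
    exact: ctsD cx (ctsN (cPF K)).
  by rewrite px; congr (_ - _); apply: eq_bigr.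
have yE : y t = PG K t.
  apply/eqP; rewrite -subr_eq0; apply/eqP.
  apply: (fourier_uniqueness_periodic (f := fun t => y t - PG K t)) => // [|s].
    exact: ctsD cy (ctsN (cPG K)).
  by rewrite py; congr (_ - _); apply: eq_bigr.
rewrite xE yE /PF /PG -/K; clearbody K; move: {null nx ny xE yE} K.
elim=> [|K IH]; first by rewrite !big_ord0.
rewrite !big_ord_recr -IH /=; apply/eqP; rewrite eq_complex /=.
by rewrite /F /G /phase !addr0 !eqxx.
Qed.

End FourierCoefficients.

(** * Bounded solutions of scalar linear equations; differentiation of means *)

Section GrowthOfSolutions.
Context {R : realType}.
Implicit Types (d b f : R -> R).

Lemma mean_value f (f' : R -> R) (a b : R) :
  (forall s, is_derive s (1 : R) f (f' s)) -> a < b ->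
  exists2 c, a < c < b & f b - f a = f' c * (b - a).
Proof.
move=> df ab.
have cf : continuous f by apply: derivable_cts => s; case: (df s).
have [c] := MVT ab (fun s _ => df s) (continuous_subspaceT cf).
by rewrite in_itv/= => ? ?; exists c.
Qed.

(** The square g of [d] satisfies g' = 2 b g >= 2 g >= 0, so g is nondecreasing
    and its slope after [s0] is at least g(s0).  Boundedness near +oo then forces
    g(s0) = 0. *)
Lemma bounded_solution_eq0 d b (B : R) :
  (forall s, is_derive s (1 : R) d (b s * d s)) -> (forall s, 1 <= b s) ->
  (\forall s \near +oo, `|d s| <= B) -> forall s, d s = 0.
Proof.
move=> dd b1 dB s0; pose g s := d s ^+ 2.
have dg s : is_derive s (1 : R) g (2 * b s * g s).
  by apply: (is_derive_eq (derX 2 (dd s))); rewrite /g /=; ring.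
have g0 s : 0 <= g s by exact: sqr_ge0.
have g_incr u v : u < v -> g u <= g v.
  move=> uv; have [c _ e] := mean_value dg uv.
  have b0 : 0 <= 2 * b c by have := b1 c; lra.
  by rewrite -subr_ge0 e; apply: mulr_ge0; [exact: mulr_ge0|rewrite subr_ge0 ltW].
have g_grow s : s0 < s -> g s0 * (s - s0) <= g s.
  move=> s0s; have [c /andP[s0c _] e] := mean_value dg s0s.
  have gc := g_incr _ _ s0c.
  have le : g s0 <= 2 * b c * g c by have := b1 c; have := g0 s0; nra.
  have : g s0 * (s - s0) <= g s - g s0 by rewrite e ler_wpM2r// subr_ge0 ltW.
  by have := g0 s0; lra.
apply/eqP; rewrite -sqrf_eq0 -/(g s0) eq_le g0 andbT leNgt; apply/negP => gt0.
near (pinfty_nbhs R) => s.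
have ds : `|d s| <= B by near: s.
have s0s : s0 < s by near: s; apply: nbhs_pinfty_gt; exact: num_real.
have : s0 + (B ^+ 2) / g s0 < s by near: s; apply: nbhs_pinfty_gt; exact: num_real.
rewrite -ltrBrDl ltr_pdivrMr// mulrC => lt.
have : g s <= B ^+ 2.
  by rewrite /g -real_normK ?num_real// ler_sqr ?nnegrE// (le_trans _ ds).
by have := g_grow _ s0s; lra.
Unshelve. all: end_near. Qed.

(** The time reversal of [bounded_solution_eq0]. *)
Lemma bounded_solution_eq0_left d b (B : R) :
  (forall s, is_derive s (1 : R) d (b s * d s)) -> (forall s, b s <= - 1) ->
  (\forall s \near -oo, `|d s| <= B) -> forall s, d s = 0.
Proof.
move=> dd b1 dB s; rewrite -[s]opprK.
apply: (@bounded_solution_eq0 (fun s => d (- s)) (fun s => - b (- s)) B).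
- move=> u; have dN : is_derive u (1 : R) (fun v : R => - v) (- 1).
    exact: is_deriveNid.
  apply: (is_derive_eq (@is_derive1_comp _ d _ _ _ _ (dd (- u)) dN)).
  by ring.
- by move=> u; rewrite lerNr.
- have [M [_ dM]] := dB; exists (- M); split; first exact: num_real.
  by move=> x Mx; apply: dM; rewrite ltrNl.
Qed.

Lemma bounded_of_limits f (l1 l2 : R) : continuous f ->
  f x @[x --> -oo] --> l1 -> f x @[x --> +oo] --> l2 ->
  exists K, forall s, `|f s| <= K.
Proof.
move=> cf f1 f2.
have [a [_ fa]] : \forall s \near -oo, `|f s| <= `|l1| + 1.
  have /cvgrPdist_le/(_ 1 ltr01) := f1; apply: filterS => s ls.
  by rewrite -lerBlDl (le_trans (lerB_dist _ _))// distrC.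
have [b [_ fb]] : \forall s \near +oo, `|f s| <= `|l2| + 1.
  have /cvgrPdist_le/(_ 1 ltr01) := f2; apply: filterS => s ls.
  by rewrite -lerBlDl (le_trans (lerB_dist _ _))// distrC.
have cn : continuous (fun s => `|f s|) by cts.
(* The segment [u, v] covers [a, b], and it is not empty even if b < a. *)
pose u := Num.min (a - 1) b; pose v := Num.max (a - 1) (b + 1).
have uv : u <= v.
  by rewrite /u /v ge_min le_max lexx.
have [c _ fc] := EVT_max uv (continuous_subspaceT cn).
exists (`|f c| + (`|l1| + `|l2| + 2)) => s.
have := normr_ge0 (f c); have := normr_ge0 l1; have := normr_ge0 l2.
have [sa|as_] := ltP s a; first by have := fa _ sa; lra.
have [bs|sb] := ltP b s; first by have := fb _ bs; lra.
have : `|f s| <= `|f c|.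
  apply: fc; rewrite in_itv/= /u /v ge_min le_max; apply/andP; split.
    by apply/orP; left; lra.
  by apply/orP; right; lra.
lra.
Qed.

(** Joint continuity bounds the partial derivative on a compact neighbourhood
    [s - 1, s + 1] x [0, 1], which gives the domination required to differentiate
    under the integral. *)
Lemma is_derive_mean (f : R -> R -> R) :
  (forall s t, derivable (f^~ t) s 1) -> (forall s, continuous (f s)) ->
  continuous (fun q : R * R => derive1 (f^~ q.2) q.1) ->
  forall s, is_derive s (1 : R) (fun s' => mean (f s'))
    (mean (fun t => derive1 (f^~ t) s)).
Proof.
move=> df cf cdf s.
pose K : set (R * R) := `[s - 1, s + 1] `*` `[0, 1].
have cK : compact K by apply: compact_setX; exact: segment_compact.
have K0 : K !=set0.
  by exists (s, 0); split; rewrite /= in_itv/= ?lexx ?ler01//; apply/andP; split; lra.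
have cn : continuous (fun q : R * R => `|derive1 (f^~ q.2) q.1|).
  by move=> q; apply: cvg_norm; exact: cdf.
have [q _ maxq] := compact_EVT_max K0 cK (continuous_subspaceT cn).
have ss : s \in `]s - 1, s + 1[ by rewrite in_itv/=; apply/andP; split; lra.
have bound x t : `]s - 1, s + 1[%classic x -> `[0, 1]%classic t ->
    `|partial1of2 f x t| <= `|derive1 (f^~ q.2) q.1|.
  move=> /= xI t1; apply: (maxq (x, t)); rewrite inE; split => //=.
  by move: xI; apply: subset_itv_oo_cc.
have intG : (@lebesgue_measure R).-integrable `[0, 1]
    (EFin \o (fun _ : R => `|derive1 (f^~ q.2) q.1|)).
  exact: integrable01 (@cts_cst _ _ _).
have intf x : `]s - 1, s + 1[%classic x ->
    (@lebesgue_measure R).-integrable `[0, 1] (EFin \o f x).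
  by move=> _; exact: integrable01.
have der x t : `]s - 1, s + 1[%classic x -> `[0, 1]%classic t ->
  derivable (f^~ t) x 1 by [].
apply: DeriveDef.
  exact: (@derivable_under_integral _ _ _ (@lebesgue_measure R) f `[0, 1]%classic
    _ s (s - 1) (s + 1) ss intf der _ _ intG bound).
rewrite -derive1E.
exact: (@differentiation_under_integral _ _ _ (@lebesgue_measure R) f `[0, 1]%classic
    _ s (s - 1) (s + 1) ss intf der _ _ intG bound).
Qed.

End GrowthOfSolutions.

(** * Coordinates and Fourier modes of loops in C^n *)

Section LinearImages.
Context {R : realType}.

Lemma is_derive_linear {V W : normedModType R} (L : V -> W) (f : R -> V) t :
  linear L -> continuous L -> derivable f t 1 ->
  is_derive t (1 : R) (fun s => L (f s)) (L (derive1 f t)).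
Proof.
move=> linL cL df; rewrite derive1E.
have L0 : L 0 = 0.
  have := linL 1 0 0; rewrite !scale1r addr0 => e.
  by apply: (addIr (L 0)); rewrite add0r -e.
have LB u v : L (u - v) = L u - L v.
  by rewrite addrC -scaleN1r linL scaleN1r addrC.
have LZ a u : L (a *: u) = a *: L u by rewrite -[a *: u]addr0 linL L0 addr0.
have cv : (fun h : R => h^-1 *: (((fun s => L (f s)) \o shift t) (h *: (1 : R)) -
    L (f t))) @ 0^' --> L ('D_1 f t).
  rewrite (_ : (fun h : R => _) =
      L \o (fun h : R => h^-1 *: ((f \o shift t) (h *: (1 : R)) - f t))).
    by apply: continuous_cvg; [exact: cL|exact: df].
  by apply/funext => h /=; rewrite LZ LB.
by split; [exact: cvgP cv|exact: cvg_lim cv].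
Qed.

Lemma is_derive_scalel {V : normedModType R} (E : V) (f : R -> R) (t a : R) :
  is_derive t (1 : R) f a -> is_derive t (1 : R) (fun s => f s *: E) (a *: E).
Proof.
move=> df; have f1 := @ex_derive _ _ _ _ _ _ _ df.
have <- : derive1 f t = a by rewrite derive1E; exact: derive_val.
apply: (@is_derive_linear R V (fun r => r *: E)) => //.
- by move=> b u v; rewrite scalerDl scalerA.
- exact: scalel_continuous.
Qed.

Variable n : nat.

Definition re_coord (j : 'I_n) (z : cspace R n) : R := z.1 j 0.
Definition im_coord (j : 'I_n) (z : cspace R n) : R := z.2 j 0.

Lemma re_coord_is_linear j : linear (re_coord j).
Proof. by move=> a u v; rewrite /re_coord/= !mxE. Qed.
Lemma im_coord_is_linear j : linear (im_coord j).
Proof. by move=> a u v; rewrite /im_coord/= !mxE. Qed.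

Lemma cts_re_coord j : continuous (re_coord j).
Proof.
move=> z; apply: (@continuous_comp _ _ _ fst (fun v : 'cV[R]_n => v j 0)).
  exact: cvg_fst.
exact: coord_continuous.
Qed.

Lemma cts_im_coord j : continuous (im_coord j).
Proof.
move=> z; apply: (@continuous_comp _ _ _ snd (fun v : 'cV[R]_n => v j 0)).
  exact: cvg_snd.
exact: coord_continuous.
Qed.

Lemma norm_coord (v : 'cV[R]_n) j : `|v j 0| <= `|v|.
Proof.
rewrite [leRHS]/Num.Def.normr/= mx_normrE.
exact: (le_trans _ (@le_bigmax _ _ _ 0 (fun ij => `|v ij.1 ij.2|) (j, 0))).
Qed.

Lemma norm_re_coord j (z : cspace R n) : `|re_coord j z| <= `|z|.
Proof. by rewrite prod_normE le_max (norm_coord z.1 j). Qed.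

Lemma norm_im_coord j (z : cspace R n) : `|im_coord j z| <= `|z|.
Proof. by rewrite prod_normE le_max (norm_coord z.2 j) orbT. Qed.

(** The loop exp(i phi) exp(2 pi i m t) e_j.  Its derivative is 2 pi m times the
    same loop with [phi] increased by pi/2, that is, multiplied by i. *)
Definition mode (j : 'I_n) (m : int) (phi : R) (t : R) : cspace R n :=
  (cos (phase m phi t) *: delta_mx j 0, sin (phase m phi t) *: delta_mx j 0).

Lemma is_derive_mode j m phi (t : R) :
  is_derive t (1 : R) (mode j m phi)
    ((2 * pi * m%:~R) *: mode j m (phi + pi / 2) t).
Proof.
pose E1 : cspace R n := (delta_mx j 0, 0); pose E2 : cspace R n := (0, delta_mx j 0).
have -> : mode j m phi = (fun s => cos (phase m phi s) *: E1) +
    (fun s => sin (phase m phi s) *: E2).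
  apply/funext => s; rewrite fctE; congr (_, _) => /=.
    by rewrite scaler0 addr0.
  by rewrite scaler0 add0r.
apply: (is_derive_eq (is_deriveD (is_derive_scalel E1 (der_cos (der_phase m phi t)))
   (is_derive_scalel E2 (der_sin (der_phase m phi t))))).
rewrite /mode phase_pihalf cosDpihalf sinDpihalf; congr (_, _) => /=.
  by rewrite scaler0 addr0 scalerA mulrC.
by rewrite scaler0 add0r scalerA mulrC.
Qed.

Lemma loops_mode j m phi : loops (mode j m phi).
Proof.
have iter k : derive1n k (mode j m phi) =
    (2 * pi * m%:~R) ^+ k *: mode j m (phi + (pi / 2) *+ k).
  elim: k => [|k IH]; first by rewrite expr0 scale1r mulr0n addr0.
  rewrite /derive1n iterS -/(derive1n k _) IH; apply/funext => t.
  rewrite derive1E; have := is_deriveZ ((2 * pi * m%:~R) ^+ k)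
    (is_derive_mode j m (phi + (pi / 2) *+ k) t).
  move=> [_ ->]; rewrite fctE scalerA -exprSr; congr (_ *: mode _ _ _ _).
  by rewrite [(pi / 2) *+ k.+1]mulrSr addrA.
split.
  move=> k t; rewrite iter; have [d _] := is_deriveZ ((2 * pi * m%:~R) ^+ k)
    (is_derive_mode j m (phi + (pi / 2) *+ k) t).
  exact: d.
by move=> t; rewrite /mode cos_phaseD1 sin_phaseD1.
Qed.

Lemma cts_re (z : R -> cspace R n) j : continuous z ->
  continuous (fun t => re_coord j (z t)).
Proof.
by move=> cz t; apply: continuous_comp; [exact: cz|exact: cts_re_coord].
Qed.

Lemma cts_im (z : R -> cspace R n) j : continuous z ->
  continuous (fun t => im_coord j (z t)).
Proof.
by move=> cz t; apply: continuous_comp; [exact: cz|exact: cts_im_coord].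
Qed.

End LinearImages.

(** * First variation of the action *)

Ltac cts_leaf ::= first
  [ assumption | apply: cts_re; assumption | apply: cts_im; assumption
  | solve [auto 2 with cts nocore] ].

Section FirstVariation.
Context {R : realType} {n k : nat} (A : 'M[int]_(n, k)) (tau : tlie R k).
Implicit Types (z w : R -> cspace R n).

Definition C1_loop z : Prop :=
  [/\ forall t, derivable z t 1, continuous z & continuous (derive1 z)].

Lemma smooth_C1 z : smooth z -> C1_loop z.
Proof.
move=> sz; have d0 t : derivable z t 1 := sz 0%N t.
have d1 t : derivable (derive1 z) t 1 := sz 1%N t.
by split; [exact: d0|exact: (derivable_cts d0)|exact: (derivable_cts d1)].
Qed.

(** The polar form of the r-th component of the moment map, normalised so that
    its value at (z, w) is the derivative at z in the direction w. *)
Definition moment_polar (r : 'I_k) (z w : cspace R n) : R :=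
  \sum_j (A j r)%:~R * (re_coord j z * re_coord j w + im_coord j z * im_coord j w).

Lemma momentE (z : cspace R n) r :
  moment A z r 0 =
  2^-1 * \sum_j (A j r)%:~R * (re_coord j z ^+ 2 + im_coord j z ^+ 2).
Proof. by rewrite /moment !mxE; congr (_ * _); apply: eq_bigr => j _; rewrite !mxE. Qed.

Lemma lambdaE (z v : cspace R n) :
  lambda z v = \sum_j im_coord j z * re_coord j v.
Proof. by []. Qed.

Lemma moment_quadratic (z w : cspace R n) (e : R) r :
  moment A (z + e *: w) r 0 =
  moment A z r 0 + (e * moment_polar r z w + e ^+ 2 * moment A w r 0).
Proof.
rewrite !momentE /moment_polar !mulr_sumr -!big_split/=; apply: eq_bigr => j _.
by rewrite /re_coord /im_coord/= !mxE; field.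
Qed.

Lemma lambda_quadratic (z w z' w' : cspace R n) (e : R) :
  lambda (z + e *: w) (z' + e *: w') =
  lambda z z' + (e * (lambda z w' + lambda w z') + e ^+ 2 * lambda w w').
Proof.
rewrite !lambdaE mulrDr !mulr_sumr -!big_split/=; apply: eq_bigr => j _.
by rewrite /re_coord /im_coord/= !mxE; ring.
Qed.

Lemma cts_eq (f g : R -> R) : f =1 g -> continuous g -> continuous f.
Proof. by move=> /funext ->. Qed.

Lemma cts_lambda z w : continuous z -> continuous w ->
  continuous (fun t => lambda (z t) (w t)).
Proof. move=> cz cw; apply: (cts_eq (fun t => lambdaE (z t) (w t))); cts. Qed.

Lemma cts_moment z r : continuous z -> continuous (fun t => moment A (z t) r 0).
Proof. move=> cz; apply: (cts_eq (fun t => momentE (z t) r)); cts. Qed.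

Lemma cts_moment_polar z w r : continuous z -> continuous w ->
  continuous (fun t => moment_polar r (z t) (w t)).
Proof. by move=> cz cw; rewrite /moment_polar; cts. Qed.

Definition first_variation (eta : tlie R k) z w : R :=
  mean (fun t => lambda (z t) (derive1 w t) + lambda (w t) (derive1 z t)) +
  \sum_r eta r 0 * mean (fun t => moment_polar r (z t) (w t)).

Lemma action0E z (eta : tlie R k) :
  action0 A tau ((z, eta) : config R n k) =
  mean (fun t => lambda (z t) (derive1 z t)) +
  \sum_r eta r 0 * (mean (fun t => moment A (z t) r 0) - tau r 0).
Proof. by rewrite /action0 /dot; congr (_ + _); apply: eq_bigr => r _; rewrite !mxE. Qed.

Lemma g0E (v : config R n k) w :
  g0 v ((w, 0) : config R n k) = mean (fun t => cdot (v.1 t) (w t)).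
Proof.
by rewrite /g0 /= /dot [X in _ + X]big1 ?addr0// => i _; rewrite mxE mulr0.
Qed.

(* From here on [mean] only enters through the lemmas above. *)
Opaque mean.

Lemma mean_quadratic (f g h : R -> R) (e : R) : continuous f -> continuous g ->
  continuous h ->
  mean (fun t => f t + (e * g t + e ^+ 2 * h t)) = mean f + (e * mean g + e ^+ 2 * mean h).
Proof. by move=> cf cg ch; rewrite !meanD ?meanZ; cts. Qed.

Lemma is_derive_quadratic (a b c : R) :
  is_derive (0 : R) (1 : R) (fun e => a + (e * b + e ^+ 2 * c)) b.
Proof.
have h1 := derM (@is_derive_id R R 0 1) (is_derive_cst b 0 (1 : R)).
have h2 := derM (derX 2 (@is_derive_id R R 0 1)) (is_derive_cst c 0 (1 : R)).
apply: (is_derive_eq (is_deriveD (is_derive_cst a 0 (1 : R)) (is_deriveD h1 h2))).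
by rewrite /cst; ring.
Qed.

(** With [eta] held fixed the action is a quadratic polynomial along every line
    in the space of loops, and [first_variation] is its linear coefficient. *)
Lemma is_derive_action0 (p : config R n k) w : C1_loop p.1 -> C1_loop w ->
  is_derive (0 : R) (1 : R)
    (fun e : R => action0 A tau (p + e *: ((w, 0) : config R n k)))
    (first_variation p.2 p.1 w).
Proof.
case: p => z eta /= [dz cz cz'] [dw cw cw'].
have clzz := cts_lambda cz cz'; have clzw := cts_lambda cz cw'.
have clwz := cts_lambda cw cz'; have clww := cts_lambda cw cw'.
have cmz r := @cts_moment _ r cz; have cmw r := @cts_moment _ r cw.
have cmp r := @cts_moment_polar _ _ r cz cw.
pose a := action0 A tau ((z, eta) : config R n k).
pose c := mean (fun t => lambda (w t) (derive1 w t)) +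
  \sum_r eta r 0 * mean (fun t => moment A (w t) r 0).
set b := first_variation eta z w.
have quad (e : R) : action0 A tau (((z, eta) : config R n k) + e *: ((w, 0) : config R n k)) =
    a + (e * b + e ^+ 2 * c).
  have -> : ((z, eta) : config R n k) + e *: ((w, 0) : config R n k) =
      (z + e *: w, eta) by congr (_, _); rewrite /= scaler0 addr0.
  have dzw t : derive1 (z + e *: w) t = derive1 z t + e *: derive1 w t.
    rewrite !derive1E deriveD; [|exact: dz|exact: derivableZ].
    by rewrite deriveZ.
  rewrite /a !action0E.
  have lamE : mean (fun t => lambda ((z + e *: w) t) (derive1 (z + e *: w) t)) =
      mean (fun t => lambda (z t) (derive1 z t)) +
      (e * mean (fun t => lambda (z t) (derive1 w t) + lambda (w t) (derive1 z t)) +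
       e ^+ 2 * mean (fun t => lambda (w t) (derive1 w t))).
    apply: etrans (mean_quadratic e clzz (ctsD clzw clwz) clww).
    by apply: eq_mean => t; rewrite dzw -lambda_quadratic.
  have mE r : mean (fun t => moment A ((z + e *: w) t) r 0) =
      mean (fun t => moment A (z t) r 0) +
      (e * mean (fun t => moment_polar r (z t) (w t)) +
       e ^+ 2 * mean (fun t => moment A (w t) r 0)).
    apply: etrans (mean_quadratic e (cmz r) (cmp r) (cmw r)).
    by apply: eq_mean => t; rewrite -moment_quadratic.
  have sumE : \sum_r eta r 0 * (mean (fun t => moment A ((z + e *: w) t) r 0) - tau r 0) =
     \sum_r eta r 0 * (mean (fun t => moment A (z t) r 0) - tau r 0) +
     (e * (\sum_r eta r 0 * mean (fun t => moment_polar r (z t) (w t))) +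
      e ^+ 2 * (\sum_r eta r 0 * mean (fun t => moment A (w t) r 0))).
    rewrite !mulr_sumr -!big_split/=; apply: eq_bigr => r _.
    rewrite mE; move: (mean _) (mean _) (mean _) (eta r 0) (tau r 0) => u v x y' t'.
    by ring.
  apply: (etrans (congr2 +%R lamE sumE)).
  rewrite /b /c /first_variation.
  by rewrite !mulrDr addrACA; congr (_ + _); rewrite addrACA.
rewrite (funext quad); exact: is_derive_quadratic.
Qed.

End FirstVariation.

(** * Variation in the direction of a Fourier mode *)

Section ModeDynamics.
Context {R : realType} {n k : nat} (A : 'M[int]_(n, k)) (tau : tlie R k).
Implicit Types (z : R -> cspace R n).

Definition loop_coef z (j : 'I_n) (m : int) (phi : R) : R :=
  coef (fun t => re_coord j (z t)) (fun t => im_coord j (z t)) m phi.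

(** The j-th component of [A *m eta], the rotation speed of the coordinate z_j
    under [eta]. *)
Definition weight (eta : tlie R k) (j : 'I_n) : R := \sum_r eta r 0 * (A j r)%:~R.

Lemma re_mode i j m phi (t : R) :
  re_coord i (mode j m phi t : cspace R n) = (i == j)%:R * cos (phase m phi t).
Proof. by rewrite /re_coord /mode/= !mxE eqxx andbT mulrC. Qed.

Lemma im_mode i j m phi (t : R) :
  im_coord i (mode j m phi t : cspace R n) = (i == j)%:R * sin (phase m phi t).
Proof. by rewrite /im_coord /mode/= !mxE eqxx andbT mulrC. Qed.

Lemma sum_delta (j : 'I_n) (f : 'I_n -> R) : \sum_i (i == j)%:R * f i = f j.
Proof.
rewrite (bigD1 j)//= eqxx mul1r big1 ?addr0// => i /negbTE ->.
by rewrite mul0r.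
Qed.

Lemma cdot_mode (z : cspace R n) j m phi t :
  cdot z (mode j m phi t) =
  re_coord j z * cos (phase m phi t) + im_coord j z * sin (phase m phi t).
Proof.
rewrite /cdot /dot; congr (_ + _).
  rewrite -(sum_delta j (fun i => re_coord i z * cos (phase m phi t))).
  by apply: eq_bigr => i _; rewrite -/(re_coord i _) -/(re_coord i _) re_mode; ring.
rewrite -(sum_delta j (fun i => im_coord i z * sin (phase m phi t))).
by apply: eq_bigr => i _; rewrite -/(im_coord i _) -/(im_coord i _) im_mode; ring.
Qed.

Lemma moment_polar_mode r (z : cspace R n) j m phi t :
  moment_polar A r z (mode j m phi t) =
  (A j r)%:~R * (re_coord j z * cos (phase m phi t) + im_coord j z * sin (phase m phi t)).
Proof.
rewrite /moment_polar -(sum_delta j (fun i => (A i r)%:~R *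
  (re_coord i z * cos (phase m phi t) + im_coord i z * sin (phase m phi t)))).
by apply: eq_bigr => i _; rewrite re_mode im_mode; ring.
Qed.

Lemma derive1_mode j m phi (t : R) :
  derive1 (mode j m phi : R -> cspace R n) t =
  (2 * pi * m%:~R) *: mode j m (phi + pi / 2) t.
Proof. by rewrite derive1E; case: (is_derive_mode j m phi t). Qed.

Lemma lambda_mode_sum (z z' : cspace R n) j m phi t :
  lambda z (derive1 (mode j m phi) t) + lambda (mode j m phi t) z' =
  im_coord j z * (2 * pi * m%:~R * - sin (phase m phi t)) +
  sin (phase m phi t) * re_coord j z'.
Proof.
rewrite !lambdaE derive1_mode.
rewrite -(sum_delta j (fun i => im_coord i z * (2 * pi * m%:~R * - sin (phase m phi t)))).
rewrite -(sum_delta j (fun i => sin (phase m phi t) * re_coord i z')).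
congr (_ + _); apply: eq_bigr => i _; last by rewrite im_mode; ring.
have -> (a : R) (v : cspace R n) : re_coord i (a *: v) = a * re_coord i v.
  by rewrite /re_coord/= mxE.
by rewrite re_mode phase_pihalf cosDpihalf; ring.
Qed.

(** The modes are eigenvectors of the linear part of the gradient,
    i d/dt + A eta: the mode [m] in the j-th coordinate has eigenvalue
    (A eta)_j - 2 pi m.  The variation of the 1-form is
    - 2 pi m times the coefficient, up to the derivative of the periodic function
    sin * x_j. *)
Lemma first_variation_mode (eta : tlie R k) z j m phi : C1_loop z ->
  (forall t, z (t + 1) = z t) ->
  first_variation A eta z (mode j m phi) =
  (weight eta j - 2 * pi * m%:~R) * loop_coef z j m phi.
Proof.
move=> [dz cz cz'] pz; rewrite /first_variation /loop_coef.
have parts : mean (fun t => lambda (z t) (derive1 (mode j m phi) t) +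
      lambda (mode j m phi t) (derive1 z t)) =
    - (2 * pi * m%:~R) * coef (fun t => re_coord j (z t)) (fun t => im_coord j (z t)) m phi.
  (* Integration by parts moves the derivative from z to the mode. *)
  pose F t := sin (phase m phi t) * re_coord j (z t).
  have dF (t : R) : is_derive t (1 : R) F (cos (phase m phi t) * (2 * pi * m%:~R) *
      re_coord j (z t) + sin (phase m phi t) * re_coord j (derive1 z t)).
    apply: derM; first exact: der_sin (der_phase m phi t).
    exact: (is_derive_linear (@re_coord_is_linear _ _ j) (@cts_re_coord _ _ j)).
  have cF' : continuous (fun t => cos (phase m phi t) * (2 * pi * m%:~R) *
      re_coord j (z t) + sin (phase m phi t) * re_coord j (derive1 z t)) by cts.
  have := mean_derive cF' dF.
  have -> : F 1 = F 0.
    rewrite /F; have := sin_phaseD1 m phi 0; have := pz 0.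
    by rewrite add0r => -> ->.
  rewrite subrr => F0; rewrite -[RHS]addr0 -F0 /coef -meanZ; cts; rewrite -meanD; cts.
  apply: eq_mean => t; rewrite lambda_mode_sum; ring.
rewrite parts mulrBl addrC mulNr; congr (_ - _).
rewrite /weight mulr_suml; apply: eq_bigr => r _; rewrite -mulrA; congr (_ * _).
rewrite /coef -meanZ; cts; apply: eq_mean => t.
by rewrite moment_polar_mode.
Qed.

End ModeDynamics.

(** * Fourier coefficients along a flow line *)

Section FlowLines.
Context {R : realType} {n k : nat} (A : 'M[int]_(n, k)) (tau : tlie R k).
Context (y : R -> config R n k).

Lemma continuous_slice {V : topologicalType} (G : R -> R -> V) (s : R) :
  continuous (fun q : R * R => G q.1 q.2) -> continuous (G s).
Proof.
move=> cG t; apply: (@continuous_comp _ _ _ (fun t => (s, t)) (fun q => G q.1 q.2)).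
  move=> B [[B1 B2] /= [n1 n2] sB]; apply: filterS n2 => u B2u.
  by apply: sB; split => //; exact: nbhs_singleton n1.
exact: cG.
Qed.

Lemma smooth_path_C1 s : smooth_path y -> C1_loop (y s).1.
Proof.
move=> [sm _ _]; have [_ dt0 c0] := sm [::]; have [_ _ c1] := sm [:: false].
split; first exact: dt0.
  exact: (@continuous_slice _ (fun s t => (y s).1 t) s c0).
exact: (@continuous_slice _ (fun s => derive1 (y s).1) s c1).
Qed.

(** Testing the gradient against a mode decouples the flow equation: every
    Fourier coefficient solves its own linear equation.  The path
    [eta] enters it only as a coefficient. *)
Lemma loop_coef_flow : smooth_path y -> gradient_flow A tau y ->
  forall j m phi s,
  is_derive s (1 : R) (fun s' => loop_coef (y s').1 j m phi)
    ((2 * pi * m%:~R - weight A (y s).2 j) * loop_coef (y s).1 j m phi).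
Proof.
move=> hy hflow j m phi s; have [sm per _] := hy.
pose D s t := derive1 (fun s' => (y s').1 t) s.
pose f s t := re_coord j ((y s).1 t) * cos (phase m phi t) +
              im_coord j ((y s).1 t) * sin (phase m phi t).
have [ds0 _ _] := sm [::]; have [_ _ cD] := sm [:: true].
have df s' t : is_derive s' (1 : R) (f^~ t) (cdot (D s' t) (mode j m phi t)).
  rewrite cdot_mode; have d := ds0 s' t.
  have dre := is_derive_linear (@re_coord_is_linear _ _ j) (@cts_re_coord _ _ j) d.
  have dim := is_derive_linear (@im_coord_is_linear _ _ j) (@cts_im_coord _ _ j) d.
  apply: (is_derive_eq (is_deriveD (derM dre (is_derive_cst (cos (phase m phi t)) _ _))
    (derM dim (is_derive_cst (sin (phase m phi t)) _ _)))).
  by rewrite !mulr0 !addr0.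
have d1f s' t : derive1 (f^~ t) s' = cdot (D s' t) (mode j m phi t).
  by rewrite derive1E; case: (df s' t).
have cf s' : continuous (f s').
  have [_ cz _] := smooth_path_C1 s' hy.
  by rewrite /f; cts.
have cdf : continuous (fun q : R * R => derive1 (f^~ q.2) q.1).
  have -> : (fun q : R * R => derive1 (f^~ q.2) q.1) =
    (fun q => re_coord j (D q.1 q.2) * cos (phase m phi q.2) +
              im_coord j (D q.1 q.2) * sin (phase m phi q.2)).
    by apply/funext => q; rewrite d1f cdot_mode.
  have csnd (g : R -> R) : continuous g -> continuous (fun q : R * R => g q.2).
    by move=> cg q; apply: continuous_comp; [exact: cvg_snd|exact: cg].
  apply: ctsD; apply: ctsM.
  - by move=> q; apply: continuous_comp; [exact: cD|exact: cts_re_coord].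
  - by apply: (csnd (fun t => cos (phase m phi t))); cts.
  - by move=> q; apply: continuous_comp; [exact: cD|exact: cts_im_coord].
  - by apply: (csnd (fun t => sin (phase m phi t))); cts.
have ex s' t : derivable (f^~ t) s' 1 by case: (df s' t).
apply: (is_derive_eq (is_derive_mean ex cf cdf s)).
have [v [[_ grad] flow]] := hflow s.
pose w : config R n k := (mode j m phi, 0).
have Lw : L0 w by split; first exact: loops_mode.
have [_ gw] := grad w Lw.
have C1w : C1_loop (mode j m phi : R -> cspace R n).
  by apply: smooth_C1; case: (@loops_mode R n j m phi).
have [_ vw] := is_derive_action0 A tau (smooth_path_C1 s hy) C1w.
have := etrans (esym vw) gw; rewrite g0E first_variation_mode; last first.
- by move=> t; exact: per.
- exact: smooth_path_C1.
move=> e.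
have vE t : v.1 t = - D s t.
  have /(congr1 fst)/(congr1 (fun h => h t)) /= := flow.
  by move/eqP; rewrite addrC addr_eq0 => /eqP.
have cm : continuous (fun t => derive1 (f^~ t) s).
  exact: (@continuous_slice _ (fun s t => derive1 (f^~ t) s) s cdf).
rewrite -[2 * pi * _ - _]opprB mulNr [X in - X]e -mulN1r -meanZ; last first.
  have -> : (fun t => cdot (v.1 t) (mode j m phi t)) =
      (fun t => - derive1 (f^~ t) s).
    apply/funext => t; rewrite d1f vE !cdot_mode /re_coord /im_coord /= !mxE.
    by ring.
  exact: ctsN.
apply: eq_mean => t; rewrite d1f vE !cdot_mode /re_coord /im_coord /= !mxE.
by ring.
Qed.

(** Uniform convergence bounds the loops near the end by 1 + |p(t)|; the factor
    2 below accounts for the two real coordinates. *)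
Lemma loop_coef_bounded_near (F : set_system R) (p : config R n k) j m phi :
  Filter F -> smooth_path y -> L0 p -> cvg_L0 y F p ->
  exists B, \forall s \near F, `|loop_coef (y s).1 j m phi| <= B.
Proof.
move=> FF hy [[sp _] _] [/(_ 0%N) unif _].
have [_ cp _] := smooth_C1 sp.
have cnp : continuous (fun t => `|p.1 t|) by move=> t; apply: cvg_norm; exact: cp.
have cB : continuous (fun t => 2 * (1 + `|p.1 t|)).
  exact: ctsM (@cts_cst _ _ _) (ctsD (@cts_cst _ _ _) cnp).
exists (mean (fun t => 2 * (1 + `|p.1 t|))).
have near1 : \forall s \near F, forall t, `|(y s).1 t| <= 1 + `|p.1 t|.
  have := unif [set h | forall t, `|h t| <= 1 + `|p.1 t|]; apply.
  apply/uniform_nbhs; exists [set q | ball q.1 1 q.2]; split.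
    exact: (@entourage_ball R (cspace R n) 1%:pos).
  move=> h /= ph t; have := ph t I; rewrite -ball_normE /= => lt.
  rewrite -lerBlDr (le_trans (lerB_dist _ _))// distrC; exact: ltW.
near=> s.
have zs : forall t, `|(y s).1 t| <= 1 + `|p.1 t| by near: s.
have [_ cz _] := smooth_path_C1 s hy.
rewrite /loop_coef /coef; apply: le_trans (le_norm_mean _) _; first by cts.
apply: le_mean => [|//|t _]; first by cts.
have abs1 (a b : R) : `|b| <= 1 -> `|a * b| <= `|a|.
  by move=> b1; rewrite normrM ler_piMr.
apply: le_trans (ler_normD _ _) _.
have c1 : `|cos (phase m phi t)| <= 1 by rewrite ler_norml cos_geN1 cos_le1.
have s1 : `|sin (phase m phi t)| <= 1 by rewrite ler_norml sin_geN1 sin_le1.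
have := abs1 (re_coord j ((y s).1 t)) _ c1; have := abs1 (im_coord j ((y s).1 t)) _ s1.
have := norm_re_coord j ((y s).1 t); have := norm_im_coord j ((y s).1 t).
have := zs t; lra.
Unshelve. all: end_near. Qed.

Lemma weight_bounded j : smooth_path y ->
  (exists2 p, L0 p & cvg_L0 y +oo p) -> (exists2 p, L0 p & cvg_L0 y -oo p) ->
  exists K, forall s, `|weight A (y s).2 j| <= K.
Proof.
move=> [_ _ seta] [p _ [_ pcv]] [q _ [_ qcv]].
have cW : continuous (fun eta : tlie R k => weight A eta j).
  by apply: cts_sum => r; apply: ctsM; [move=> eta; exact: coord_continuous|exact: cts_cst].
have ceta : continuous (fun s => (y s).2).
  by apply: derivable_cts => s; exact: (seta 0%N s).
apply: (@bounded_of_limits R (fun s => weight A (y s).2 j) (weight A q.2 j) (weight A p.2 j)).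
- move=> s.
  apply: (@continuous_comp _ _ _ (fun s => (y s).2) (fun eta => weight A eta j)).
    exact: ceta.
  exact: cW.
- exact: (continuous_cvg _ (cW q.2) qcv).
- exact: (continuous_cvg _ (cW p.2) pcv).
Qed.

(** Since 2 pi >= 1, any M > sup |(A eta)_j| makes 2 pi m - (A eta)_j at least 1
    for m > M and at most -1 for m < - M, uniformly in s.  In the first case the
    coefficient would grow towards +oo, in the second towards -oo, and the limit
    at that end forbids it. *)
Lemma loop_coef_eq0 j : smooth_path y -> gradient_flow A tau y ->
  (exists2 p, L0 p & cvg_L0 y +oo p) -> (exists2 p, L0 p & cvg_L0 y -oo p) ->
  exists M : nat, forall s (m : int) phi, (M < `|m|)%N ->
    loop_coef (y s).1 j m phi = 0.
Proof.
move=> hy hflow hp hm; have [K WK] := weight_bounded j hy hp hm.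
have K0 : 0 <= K := le_trans (normr_ge0 _) (WK 0).
have KM := archi_boundP K0; set M := Num.Def.archi_bound K in KM.
exists M => s m phi Mm.
have W s' := WK s'; have dc := loop_coef_flow hy hflow j m phi.
have pi2 := @pi_ge2 R.
have MmR : M%:R + 1 <= `|m%:~R| :> R.
  by rewrite -intr_norm -abszE natr1 ler_nat.
have [m0|m0] := leP 0 m.
- have [p Lp cv] := hp; have [B nB] := loop_coef_bounded_near j m phi _ hy Lp cv.
  apply: (@bounded_solution_eq0 R (fun s => loop_coef (y s).1 j m phi) _ B dc _ nB).
  move=> u; have := W u; rewrite ler_norml => /andP[_ Wu].
  rewrite ger0_norm ?ler0z// in MmR; nra.
- have [p Lp cv] := hm; have [B nB] := loop_coef_bounded_near j m phi _ hy Lp cv.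
  apply: (@bounded_solution_eq0_left R (fun s => loop_coef (y s).1 j m phi) _ B dc _ nB).
  move=> u; have := W u; rewrite ler_norml => /andP[Wu _].
  rewrite ltr0_norm ?ltrz0// in MmR; nra.
Qed.

End FlowLines.

Unset Implicit Arguments.

Theorem theoremB (R : realType) (n k : nat) (hk : (1 <= k)%N) (hkn : (k <= n)%N)
  (A : 'M[int]_(n, k)) (tau : tlie R k)
  (hproper : proper_map (moment A : cspace R n -> tlie R k))
  (hregular : regular_value (moment A : cspace R n -> tlie R k) tau)
  (y : R -> config R n k) (hy : smooth_path y)
  (hflow : gradient_flow A tau y)
  (hlimp : exists2 p, L0 p & cvg_L0 y +oo p)
  (hlimm : exists2 p, L0 p & cvg_L0 y -oo p) :
  exists mm mp : 'I_n -> int,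
    (forall j, mm j <= mp j) /\
    forall s : R, (trig_loops mm mp `*` setT) (y s).
Proof.
have /choice[M M0] j := loop_coef_eq0 j hy hflow hlimp hlimm.
exists (fun j => - (M j)%:Z), (fun j => (M j)%:Z); split=> [j|s]; first by lia.
split=> //.
pose x j t := re_coord j ((y s).1 t); pose x' j t := im_coord j ((y s).1 t).
exists (fun j m => (coef (x j) (x' j) m 0 +i* coef (x j) (x' j) m (pi / 2))%C) => t j.
have -> : `|((M j)%:Z - - (M j)%:Z)%R|%N = (M j).*2 by lia.
have [_ cz _] := smooth_path_C1 s hy; have [_ per _] := hy.
apply: (@trig_poly_of_coef R (x j) (x' j) (M j)) => [||||m phi Mm].
- exact: cts_re.
- exact: cts_im.
- by move=> u; rewrite /x per.
- by move=> u; rewrite /x' per.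
- exact: M0.
Qed.
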